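(* There exists a unique complex equiangular $(7,3)$-frame up to equivalence; that is, a complex equiangular $(7,3)$-frame exists, and the Gram matrices of any two complex equiangular $(7,3)$-frames are equivalent.
   Context: For integers $n\ge m\ge 1$ (with $n\geq 2$), a complex equiangular tight frame, or complex equiangular $(n,m)$-frame, is a collection of $n$ unit vectors $\varphi_1,\dots,\varphi_n\in\mathbb{C}^m$ such that $|\langle\varphi_i,\varphi_j\rangle|=\alpha_{n,m}:=\sqrt{\frac{n-m}{m(n-1)}}$ for all $1\le i<j\le n$, and which is tight: the $m\times n$ matrix $F$ with columns $\varphi_1,\dots,\varphi_n$ has pairwise orthogonal rows of equal norm, i.e. $FF^\ast=\frac{n}{m}I_m$. Its Gram matrix is $G:=F^\ast F$; it is self-adjoint with unit diagonal, off-diagonal entries of modulus $\alpha_{n,m}$, and satisfies $mG^2=nG$. Two Gram matrices $G,G'$ of the same order are called equivalent if $G'=PDGD^\ast P^T$ for some permutation matrix $P$ and some unitary diagonal matrix $D$. *)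

(* Defs.v *)
From HB Require Import structures.
From mathcomp Require Import all_boot all_order all_fingroup all_algebra.
From mathcomp Require Export spectral sesquilinear.
From mathcomp Require Export complex reals.

Set Implicit Arguments.
Unset Strict Implicit.
Unset Printing Implicit Defensive.

Import Order.TTheory GRing.Theory Num.Theory.
Local Open Scope ring_scope.
Local Open Scope sesquilinear_scope.

Section EquiangularTightFrames.
Variable C : numClosedFieldType.

(* Hermitian product on column vectors, linear in the second argument, so that
   the Gram matrix F^* F has entries <phi_i, phi_j>. *)
Definition hdot m (u v : 'cV[C]_m) : C := (u ^t* *m v) 0 0.

Definition hnorm m (u : 'cV[C]_m) : C := sqrtC (hdot u u).

Definition frame_mx m n (phi : 'I_n -> 'cV[C]_m) : 'M[C]_(m, n) :=
  \matrix_(k, i) phi i k 0.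

Definition gram_mx m n (phi : 'I_n -> 'cV[C]_m) : 'M[C]_n :=
  (frame_mx phi) ^t* *m frame_mx phi.

Definition etf_angle (n m : nat) : C :=
  sqrtC ((n%:R - m%:R) / (m%:R * (n%:R - 1))).

Record equiangular_frame (n m : nat) (phi : 'I_n -> 'cV[C]_m) : Prop := {
  etf_m_ge1 : (1 <= m)%N;
  etf_m_le_n : (m <= n)%N;
  etf_n_ge2 : (2 <= n)%N;
  etf_unit : forall i, hnorm (phi i) = 1;
  etf_equiangular : forall i j : 'I_n, (i < j)%N ->
    `|hdot (phi i) (phi j)| = etf_angle n m;
  etf_tight : frame_mx phi *m (frame_mx phi) ^t* = (n%:R / m%:R)%:M
}.

Definition gram_equiv n (G G' : 'M[C]_n) : Prop :=
  exists P D : 'M[C]_n,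
    [/\ is_perm_mx P, is_diag_mx D, D \is unitarymx
      & G' = P *m D *m G *m D ^t* *m P^T].

End EquiangularTightFrames.

(* Main.v *)
(* Write P_i for the projection onto the line of the i-th frame vector. The
   P_i are seven equiangular points of the 9-dimensional real space of Hermitian
   3 x 3 matrices, so the orthogonal complement of their span has an orthonormal
   basis A, B, and the completeness relation expresses the sum of the tensors
   P_i (x) P_i through the identity, A (x) A and B (x) B. That sum vanishes on
   antisymmetric tensors, which forces A^2 + B^2 = 2/3 and AB = BA. In an
   eigenbasis of A + iB every frame vector has all its coordinates of modulus
   1/sqrt 3, i.e. it is (1, x_i, y_i) / sqrt 3 up to phases. Equiangularity now
   says that the seven characters 1, x^+-1, y^+-1, (x/y)^+-1 are orthogonal on
   the seven points (x_i, y_i). Expanding x/y^2 in this basis leaves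
   x/y^2 = s y + t y/x, and unimodularity gives st = 0: hence x = y^3 or
   x^2 = y^3. In both cases the points form the cyclic group of order 7, and the
   Gram matrix is that of the difference set {0, 1, 3} modulo 7. *)
Require Import Defs.
From mathcomp Require Import all_boot all_order all_fingroup all_algebra.
From mathcomp Require Import complex reals ring.

Set Implicit Arguments.
Unset Strict Implicit.
Unset Printing Implicit Defensive.

Import Order.TTheory GRing.Theory Num.Theory.
Local Open Scope ring_scope.
Local Open Scope sesquilinear_scope.

(** * Orthonormal completion over a real closed field *)

Lemma unit_kernel_vector (R : rcfType) m n (Q : 'M[R]_(m, n)) : (m < n)%N ->
  exists2 u : 'rV[R]_n, u *m u^T = 1%:M & Q *m u^T = 0.
Proof.
move=> lt_mn; have /rowV0Pn[v v_ker v_neq0] : kermx Q^T != 0.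
  rewrite kermx_eq0 -row_leq_rank -ltnNge; apply: leq_ltn_trans lt_mn.
  exact: rank_leq_col.
have vvT : v *m v^T = (\sum_k v 0 k ^+ 2)%:M.
  rewrite [LHS]mx11_scalar; congr (_%:M); rewrite mxE; apply: eq_bigr => k _.
  by rewrite mxE expr2.
have s_gt0 : 0 < \sum_k v 0 k ^+ 2.
  rewrite lt_def sumr_ge0 ?andbT => [|k _]; last exact: sqr_ge0.
  apply: contraNneq v_neq0 => /eqP; rewrite psumr_eq0 => [/allP v0|k _].
    apply/eqP/rowP=> k; apply/eqP; rewrite mxE -sqrf_eq0.
    exact: (implyP (v0 k (mem_index_enum k))).
  exact: sqr_ge0.
move: s_gt0 vvT; set s := \sum_k _ => s_gt0 vvT.
have s_neq0 : Num.sqrt s != 0 by rewrite gt_eqF // sqrtr_gt0.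
exists ((Num.sqrt s)^-1 *: v).
  rewrite linearZ /= -scalemxAr -scalemxAl vvT scalerA -invfM -expr2.
  by rewrite sqr_sqrtr ?ltW // scale_scalar_mx mulVf // gt_eqF.
rewrite linearZ /= -scalemxAr; apply/eqP; rewrite scaler_eq0; apply/orP; right.
by move: v_ker => /sub_kermxP/(congr1 trmx); rewrite trmx_mul trmxK trmx0 => /eqP.
Qed.

(** By induction on [p]: a unit vector orthogonal to the rows of both [Q] and the current [K] exists
    while [m + p < n], and is stacked on [K]. *)
Lemma orthonormal_kernel (R : rcfType) m n p (Q : 'M[R]_(m, n)) :
  (m + p <= n)%N ->
  exists2 K : 'M[R]_(p, n), K *m K^T = 1%:M & Q *m K^T = 0.
Proof.
elim: p => [|p IHp] le_n.
  by exists 0; [apply/matrixP=> [[]] | rewrite trmx0 mulmx0].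
have [|K KK QK] := IHp; first by apply: leq_trans le_n; rewrite addnS.
have [|u uu Mu] := unit_kernel_vector (col_mx Q K).
  by apply: leq_trans le_n; rewrite addnS.
move: Mu; rewrite mul_col_mx -col_mx0 => /eq_col_mx[Qu Ku].
have uK : u *m K^T = 0 by rewrite -[u]trmxK -trmx_mul Ku trmx0.
rewrite -[p.+1]/(1 + p)%N; exists (col_mx u K).
  by rewrite tr_col_mx mul_col_row uu KK uK Ku -scalar_mx_block.
by rewrite tr_col_mx mul_mx_row Qu QK row_mx0.
Qed.

(** [S] inverts the Gram matrix of the rows of [Q], so the square matrix [col_mx Q K] has right
    inverse [row_mx (Q^T *m S) K^T]. It is also a left inverse, which is the completeness
    relation. *)
Lemma orthonormal_completion (R : comUnitRingType) m p
    (Q : 'M[R]_(m, m + p)) (K : 'M[R]_(p, m + p)) (S : 'M[R]_m) :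
    Q *m Q^T *m S = 1%:M -> K *m K^T = 1%:M -> Q *m K^T = 0 ->
  Q^T *m S *m Q + K^T *m K = 1%:M.
Proof.
move=> QQS KK QK; have KQ : K *m Q^T = 0 by rewrite -[K]trmxK -trmx_mul QK trmx0.
have /mulmx1C : col_mx Q K *m row_mx (Q^T *m S) K^T = 1%:M.
  by rewrite mul_col_row !mulmxA QQS KK KQ QK mul0mx -scalar_mx_block.
by rewrite mul_row_col.
Qed.

(** * Hermitian matrices as a real Euclidean space *)

Lemma mxvec_index_inj m n k l k' l' :
  (@mxvec_index m n k l == mxvec_index k' l') = (k == k') && (l == l').
Proof.
apply/eqP/andP => [/cast_ord_inj/enum_rank_inj[-> ->]|[/eqP-> /eqP->]] //.
Qed.

Lemma mxvec_sum (V : nmodType) m n (f : 'I_(m * n) -> V) :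
  \sum_a f a = \sum_k \sum_l f (mxvec_index k l).
Proof.
rewrite (reindex _ (curry_mxvec_bij m n)) /= pair_bigA /=.
by apply: eq_bigr => [[]].
Qed.

Section HermitianEncoding.
Variable R : rcfType.
Local Open Scope complex_scope.
Local Notation C := R[i].
Local Notation half_1Di := (2^-1 +i* 2^-1 : C).
Local Notation half_1Bi := (2^-1 -i* 2^-1 : C).

(* Real matrices X encode Hermitian ones by X = Re H + Im H entrywise: the real
   part of H is symmetric and the imaginary part antisymmetric, hence orthogonal,
   so the encoding is an isometry. *)
Definition herm_of n (X : 'M[R]_n) : 'M[C]_n :=
  \matrix_(k, l) (half_1Di * (X k l)%:C + half_1Bi * (X l k)%:C).

Lemma herm_of_hermitian n (X : 'M[R]_n) : (herm_of X)^t* = herm_of X.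
Proof.
apply/matrixP => k l; rewrite !mxE; apply/eqP.
by rewrite eq_complex /=; apply/andP; split; apply/eqP; ring.
Qed.

(** Expanding gives four sums, equal in pairs after exchanging [k] and [l]. The squares of (1+i)/2
    and (1-i)/2 cancel, and twice their product is 1. *)
Lemma herm_of_mxtrace n (X Y : 'M[R]_n) :
  \tr (herm_of X *m herm_of Y) = (\sum_k \sum_l X k l * Y k l)%:C.
Proof.
pose s (x y : C) (f : 'I_n -> 'I_n -> R) : C := x * y * (\sum_k \sum_l f k l)%:C.
transitivity (s half_1Di half_1Di (fun k l => X k l * Y l k)
   + s half_1Di half_1Bi (fun k l => X k l * Y k l)
   + s half_1Bi half_1Di (fun k l => X l k * Y l k)
   + s half_1Bi half_1Bi (fun k l => X l k * Y k l)).
  rewrite /s !rmorph_sum !mulr_sumr -!big_split; apply: eq_bigr => k _ /=.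
  rewrite mxE !rmorph_sum !mulr_sumr -!big_split; apply: eq_bigr => l _ /=.
  rewrite !mxE !rmorphM /=; ring.
rewrite /s [in X in _ + X + _]exchange_big [in X in _ + X]exchange_big /=.
move: (\sum_k _) (\sum_k _) => a b.
by apply/eqP; rewrite eq_complex /=; apply/andP; split; apply/eqP; field.
Qed.

Lemma herm_ofK n (P : 'M[C]_n) : P^t* = P ->
  herm_of (\matrix_(k, l) (complex.Re (P k l) + complex.Im (P k l))) = P.
Proof.
move=> P_herm; apply/matrixP => k l; rewrite !mxE.
rewrite -[P l k]conjCK; have -> : (P l k)^*%R = P k l by rewrite -[in RHS]P_herm !mxE.
case: (P k l) => a b; apply/eqP.
by rewrite eq_complex /=; apply/andP; split; apply/eqP; field.
Qed.

(* A and B span the orthogonal complement of the P_i; the last item is the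
   completeness relation for the P_i together with A and B, where 2/3 comes from
   inverting the Gram matrix 7/9 + 2/9 J of the P_i. *)
Lemma hermitian_complement (P : 'I_7 -> 'M[C]_3) :
    (forall i, (P i)^t* = P i) ->
    (forall i j, \tr (P i *m P j) = (i == j)%:R * (7 / 9) + 2 / 9) ->
    \sum_i P i = (7 / 3)%:M ->
  exists A B : 'M[C]_3,
    [/\ A^t* = A /\ B^t* = B,
        forall i, \tr (P i *m A) = 0 /\ \tr (P i *m B) = 0,
        [/\ \tr (A *m A) = 1, \tr (B *m B) = 1 & \tr (A *m B) = 0]
      & forall k l k' l', 9 / 7 * (\sum_i P i k l * P i k' l') =
          (k == l')%:R * (l == k')%:R + 2 / 3 * (k == l)%:R * (k' == l')%:R
          - A k l * A k' l' - B k l * B k' l'].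
Proof.
move=> P_herm trPP sumP.
pose X i : 'M[R]_3 := \matrix_(k, l) (complex.Re (P i k l) + complex.Im (P i k l)).
have hX i : herm_of (X i) = P i by exact: herm_ofK.
pose Q : 'M[R]_(7, 3 * 3) := \matrix_i mxvec (X i).
have QE i k l : Q i (mxvec_index k l) = X i k l.
  by rewrite mxE mxvecE.
move: Q QE => Q QE.
(* Seven rows in dimension nine leave room for two more: the encodings of A and B. *)
have [K KK QK] := @orthonormal_kernel R 7 (3 * 3) 2 Q isT.
pose Y (a : 'I_2) : 'M[R]_3 := vec_mx (row a K).
have KE a k l : K a (mxvec_index k l) = Y a k l by rewrite !mxE.
move: Y KE => Y KE.
have trPY i a : \tr (P i *m herm_of (Y a)) = 0.
  rewrite -hX herm_of_mxtrace; have /matrixP/(_ i a) := QK.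
  rewrite !mxE mxvec_sum => QK0.
  rewrite -[RHS](rmorph0 (real_complex R)) -[in RHS]QK0; congr _%:C.
  apply: eq_bigr => k _; apply: eq_bigr => l _.
  by rewrite [K^T _ _]mxE QE KE.
have trYY a b : \tr (herm_of (Y a) *m herm_of (Y b)) = (a == b)%:R.
  rewrite herm_of_mxtrace; have /matrixP/(_ a b) := KK.
  rewrite !mxE mxvec_sum => KKab.
  rewrite -(rmorph_nat (real_complex R)) -KKab; congr _%:C.
  apply: eq_bigr => k _; apply: eq_bigr => l _.
  by rewrite [K^T _ _]mxE !KE.
pose e : 'cV[R]_7 := const_mx 1.
have ee : e^T *m e = 7%:M.
  rewrite [LHS]mx11_scalar mxE; congr (_%:M).
  under eq_bigr do rewrite !mxE mulr1.
  by rewrite sumr_const card_ord.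
have QQ : Q *m Q^T = (7 / 9)%:M + (2 / 9) *: (e *m e^T).
  apply/matrixP => i j; apply: complexI; rewrite !mxE mxvec_sum.
  transitivity (\tr (P i *m P j)).
    rewrite -!hX herm_of_mxtrace; congr _%:C.
    apply: eq_bigr => k _; apply: eq_bigr => l _.
    by rewrite [Q^T _ _]mxE !QE.
  rewrite trPP big_ord1 !mxE !mulr1 rmorphD rmorphMn !fmorph_div !rmorph_nat.
  by rewrite mulr_natl.
(* [J = e *m e^T] is the all-ones matrix and J^2 = 7J, so 7/9 + 2/9 J has inverse 9/7 - 6/49 J. *)
have QQS : Q *m Q^T *m ((9 / 7)%:M - (6 / 49) *: (e *m e^T)) = 1%:M.
  have JJ : e *m e^T *m (e *m e^T) = 7 *: (e *m e^T).
    by rewrite mulmxA -(mulmxA e) ee mul_mx_scalar scalemxAl.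
  rewrite QQ mulmxDl !mulmxBr !mul_scalar_mx !mul_mx_scalar -!scalemxAl -!scalemxAr JJ.
  rewrite scale_scalar_mx !scalerA.
  by move: (e *m e^T) => J; apply/matrixP=> i j; rewrite !mxE; case: eqP => _; field.
have sQ k l : \sum_i X i k l = 7 / 3 * (k == l)%:R.
  transitivity (complex.Re ((7 / 3)%:M k l : C) + complex.Im ((7 / 3)%:M k l : C)).
    rewrite -sumP summxE !raddf_sum -big_split; apply: eq_bigr => i _.
    by rewrite mxE.
  have -> : (7 / 3 : C) = (7 / 3 : R)%:C by rewrite fmorph_div !rmorph_nat.
  by rewrite mxE; case: eqP => _ /=; rewrite ?mulr1 ?mulr0 addr0.
have T k l k' l' : 9 / 7 * (\sum_i X i k l * X i k' l') =
    ((k == k') && (l == l'))%:R + 2 / 3 * (k == l)%:R * (k' == l')%:R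
    - Y 0 k l * Y 0 k' l' - Y 1 k l * Y 1 k' l'.
  have : Q^T *m ((9 / 7)%:M - (6 / 49) *: (e *m e^T)) *m Q + K^T *m K = 1%:M.
    exact: orthonormal_completion QQS KK QK.
  move=> /matrixP/(_ (mxvec_index k l) (mxvec_index k' l')).
  rewrite mulmxBr mulmxBl mul_mx_scalar -scalemxAr -!scalemxAl.
  (* Both factors are 7/3 times the vectorized identity, because the [P i] sum to 7/3; hence the
     coefficient 6/49 * (7/3)^2 = 2/3. *)
  have -> : Q^T *m (e *m e^T) *m Q = (Q^T *m e) *m (e^T *m Q) by rewrite !mulmxA.
  have Qe k0 l0 : (Q^T *m e) (mxvec_index k0 l0) 0 = 7 / 3 * (k0 == l0)%:R.
    rewrite mxE -sQ; apply: eq_bigr => i _.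
    by rewrite [Q^T _ _]mxE QE [e _ _]mxE mulr1.
  have eQ k0 l0 : (e^T *m Q) 0 (mxvec_index k0 l0) = 7 / 3 * (k0 == l0)%:R.
    by rewrite -[e^T *m Q]trmxK trmx_mul trmxK mxE Qe.
  move: (Q^T *m e) (e^T *m Q) Qe eQ => v w vE wE.
  rewrite !mxE big_ord1 vE wE mxvec_index_inj.
  rewrite !(@big_ord_recl _ _ _ 1) !(@big_ord_recl _ _ _ 0) big_ord0.
  have -> : lift ord0 ord0 = 1 :> 'I_2 by exact: val_inj.
  rewrite ![K^T _ _]mxE !KE => E.
  have -> : \sum_i X i k l * X i k' l' =
      \sum_j Q^T (mxvec_index k l) j * Q j (mxvec_index k' l').
    by apply: eq_bigr => i _; rewrite [Q^T _ _]mxE !QE.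
  by rewrite -E; field.
exists (herm_of (Y 0)), (herm_of (Y 1)); split => //.
- by split; exact: herm_of_hermitian.
move=> k l k' l'.
have -> : 9 / 7 * (\sum_i P i k l * P i k' l') =
    half_1Di * half_1Di * (9 / 7 * (\sum_i X i k l * X i k' l'))%:C
  + half_1Di * half_1Bi * (9 / 7 * (\sum_i X i k l * X i l' k'))%:C
  + half_1Bi * half_1Di * (9 / 7 * (\sum_i X i l k * X i k' l'))%:C
  + half_1Bi * half_1Bi * (9 / 7 * (\sum_i X i l k * X i l' k'))%:C.
  rewrite !rmorphM !rmorph_sum !fmorphV !rmorph_nat !mulr_sumr.
  rewrite -!big_split; apply: eq_bigr => i _ /=.
  rewrite -!hX !mxE !rmorphM /=; ring.
rewrite !T !mxE !(eq_sym l) !(eq_sym l' k') -!mulnb !natrM.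
have g0 : half_1Di * half_1Di + half_1Bi * half_1Bi = 0.
  by apply/eqP; rewrite eq_complex /=; apply/andP; split; apply/eqP; field.
have g1 : 2 * half_1Di * half_1Bi - 1 = 0.
  by apply/eqP; rewrite eq_complex /=; apply/andP; split; apply/eqP; field.
move: half_1Di half_1Bi g0 g1 => g h g0 g1.
(* With g and h abstract, the two sides differ by multiples of g^2 + h^2 and 2gh - 1; these zero
   terms are inserted with their cofactors so that [field] can close the goal. *)
pose d : C := 2 / 3 * (k == l)%:R * (k' == l')%:R.
rewrite -[RHS]addr0 -[in RHS](mul0r ((k == k')%:R * (l' == l)%:R + d)) -[in RHS]g0.
rewrite -[RHS]addr0 -[in RHS](mul0r ((k == l')%:R * (k' == l)%:R + d)) -[in RHS]g1.
by rewrite /d; field.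
Qed.
End HermitianEncoding.

(** * Flattening the frame *)

(** Sum the hypothesis against [M l k'] over [l] and [k']: the direct products become [X *m M *m X],
    the swapped ones [\tr (M *m X) *: X], for [X] equal to [A] or [B]. *)
Lemma antisymmetric_contraction (F : fieldType) n (A B M : 'M[F]_n) (c : F) :
    (forall k l k' l', A k l * A k' l' + B k l * B k' l'
                     - A k l' * A k' l - B k l' * B k' l =
       c * ((k == l')%:R * (l == k')%:R - (k == l)%:R * (k' == l')%:R)) ->
  A *m M *m A + B *m M *m B - \tr (M *m A) *: A - \tr (M *m B) *: B =
    c *: ((\tr M)%:M - M).
Proof.
move=> AB; apply/matrixP => k l'.
have trE (X : 'M[F]_n) : (X *m M *m X) k l' - \tr (M *m X) * X k l' =
    \sum_k' \sum_l M l k' * (X k l * X k' l' - X k l' * X k' l).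
  rewrite [LHS]/= /mxtrace [(_ *m M *m _) _ _]mxE.
  under [\sum_i (M *m X) i i]eq_bigr do rewrite mxE.
  rewrite exchange_big mulr_suml -sumrB; apply: eq_bigr => k' _.
  rewrite mxE !mulr_suml -sumrB; apply: eq_bigr => l _; ring.
transitivity (\sum_k' \sum_l M l k' *
   (c * ((k == l')%:R * (l == k')%:R - (k == l)%:R * (k' == l')%:R))).
  transitivity ((A *m M *m A) k l' - \tr (M *m A) * A k l' +
      ((B *m M *m B) k l' - \tr (M *m B) * B k l')).
    by move: (A *m M *m A) (B *m M *m B) => X Y; rewrite !mxE; ring.
  rewrite !trE -big_split; apply: eq_bigr => k' _.
  by rewrite -big_split; apply: eq_bigr => l _; rewrite -AB /=; ring.
transitivity (c * \sum_k' ((k == l')%:R * M k' k' - (k' == l')%:R * M k k')).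
  rewrite mulr_sumr; apply: eq_bigr => k' _.
  under eq_bigr => l _ do rewrite mulrCA mulrBr.
  rewrite -mulr_sumr sumrB; congr (_ * (_ - _)).
    rewrite (bigD1 k') //= eqxx mulr1 big1 ?addr0 1?mulrC // => l /negPf->.
    by rewrite !mulr0.
  rewrite (bigD1 k) //= eqxx mul1r big1 ?addr0 1?mulrC // => l.
  by rewrite eq_sym => /negPf->; rewrite mul0r mulr0.
rewrite sumrB -mulr_sumr !mxE; congr (_ * (_ - _)).
  by rewrite mulr_natl.
rewrite (bigD1 l') //= eqxx mul1r big1 ?addr0 // => k' /negPf->.
by rewrite mul0r.
Qed.

(* Contracting the tensor identity with A gives A^3 + BAB = 2/3 A, whereas
   A^2 + B^2 = 2/3 gives A^3 + B^2 A = 2/3 A; so B, and likewise A, annihilates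
   the commutator. *)
Lemma commuting_pair (F : numFieldType) (A B : 'M[F]_3) :
    \tr A = 0 -> \tr B = 0 ->
    [/\ \tr (A *m A) = 1, \tr (B *m B) = 1 & \tr (A *m B) = 0] ->
    (forall k l k' l', A k l * A k' l' + B k l * B k' l'
                     - A k l' * A k' l - B k l' * B k' l =
       3^-1 * ((k == l')%:R * (l == k')%:R - (k == l)%:R * (k' == l')%:R)) ->
  A *m B = B *m A /\ A *m A + B *m B = (2 / 3)%:M.
Proof.
move=> trA trB [trAA trBB trAB] /antisymmetric_contraction AB.
have AABB : A *m A + B *m B = (2 / 3)%:M.
  have := AB 1%:M; rewrite !mulmx1 !mul1mx trA trB !scale0r !subr0 => ->.
  by rewrite mxtrace1 -raddfB scale_scalar_mx; congr _%:M; field.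
split => //; have trBA : \tr (B *m A) = 0 by rewrite mxtrace_mulC.
have AAA : A *m A *m A + B *m A *m B = (2 / 3) *: A.
  move/eqP: (AB A); rewrite trAA trAB trA !subr_eq => /eqP ->.
  by apply/matrixP => i j; rewrite !mxE mul0rn; field.
have BBB : A *m B *m A + B *m B *m B = (2 / 3) *: B.
  move/eqP: (AB B); rewrite trBA trBB trB !subr_eq => /eqP ->.
  by apply/matrixP => i j; rewrite !mxE mul0rn; field.
have AS : (A *m A + B *m B) *m A = (2 / 3) *: A by rewrite AABB mul_scalar_mx.
have BS : (A *m A + B *m B) *m B = (2 / 3) *: B by rewrite AABB mul_scalar_mx.
have BBA : B *m B *m A = B *m A *m B.
  by move: AS; rewrite -AAA mulmxDl => /addrI.
have AAB : A *m A *m B = A *m B *m A.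
  by move: BS; rewrite -BBB mulmxDl => /addIr.
have : (A *m A + B *m B) *m (A *m B - B *m A) = 0.
  have A0 : A *m (A *m B - B *m A) = 0 by rewrite mulmxBr !mulmxA AAB subrr.
  have B0 : B *m (A *m B - B *m A) = 0 by rewrite mulmxBr !mulmxA BBA subrr.
  by rewrite mulmxDl -!mulmxA A0 B0 !mulmx0 addr0.
rewrite AABB mul_scalar_mx => /eqP; rewrite scaler_eq0 subr_eq0.
by rewrite mulf_eq0 invr_eq0 !pnatr_eq0 => /eqP.
Qed.

Section Flattening.
Variable C : numClosedFieldType.

Lemma sum_ord3 (V : nmodType) (f : 'I_3 -> V) k :
  \sum_l f l = f k + f (k + 1) + f (k + 2).
Proof.
rewrite !big_ord_recl big_ord0 addr0 addrA.
have [E0 E1 E2] : [/\ ord0 = 0 :> 'I_3, lift ord0 ord0 = 1 :> 'I_3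
    & lift ord0 (lift ord0 ord0) = 2 :> 'I_3] by split; exact: val_inj.
rewrite E0 E1 E2.
have : k \in [:: 0; 1; 2] by case: k => [[|[|[|]]]].
rewrite !inE => /or3P[] /eqP->.
- by rewrite !add0r.
- have -> : 1 + 1 = 2 :> 'I_3 by [].
  have -> : 1 + 2 = 0 :> 'I_3 by exact: val_inj.
  by rewrite -addrA addrC.
- have -> : 2 + 1 = 0 :> 'I_3 by exact: val_inj.
  have -> : 2 + 2 = 1 :> 'I_3 by exact: val_inj.
  by rewrite addrC addrA.
Qed.

(** Three numbers of equal modulus and sum zero form an equilateral triangle centred at 0, whose
    only real barycentric coordinates for the centre are 1/3 each. *)
Lemma flat_coordinates (d p : 'I_3 -> C) (c : C) : c != 0 ->
    (forall k, d k * (d k)^* = c) -> \sum_k d k = 0 ->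
    (forall k, (p k)^* = p k) -> \sum_k p k = 1 -> \sum_k d k * p k = 0 ->
  forall k, p k = 3^-1.
Proof.
move=> c_neq0 dd sd conjp sp sdp k; rewrite !(sum_ord3 _ k) in sd sp sdp.
move: (dd k) (dd (k + 1)) (dd (k + 2)) (conjp k) (conjp (k + 1)) (conjp (k + 2)).
move: (d k) (d (k + 1)) (d (k + 2)) (p k) (p (k + 1)) (p (k + 2)) sd sp sdp.
move=> a b m x y z sd sp sdp aa bb mm xx yy zz.
have dot u v w : u + v + w = 0 -> u * u^* = c -> v * v^* = c -> w * w^* = c ->
    u * v^* + u^* * v = - c.
  move=> suvw uu vv ww.
  have wE : w = - (u + v) by apply/eqP; rewrite -subr_eq0 opprK addrC suvw.
  have uvuv : (u + v) * (u^* + v^*) = c.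
    by rewrite -ww wE rmorphN rmorphD /= mulrNN.
  transitivity ((u + v) * (u^* + v^*) - u * u^* - v * v^*); first ring.
  by rewrite uvuv uu vv; ring.
have ab := dot _ _ _ sd aa bb mm.
have amb : a + m + b = 0 by rewrite addrAC.
have am := dot _ _ _ amb aa mm bb.
have sdp' := congr1 (fun t => t^*) sdp.
rewrite /= rmorph0 !rmorphD !rmorphM /= xx yy zz in sdp'.
(* Pair the balance relation with [a] and add its conjugate: this leaves c(2x - y - z), and x + y +
   z = 1. *)
have : c * (3 * x - 1) = 0.
  rewrite -[X in _ - X]sp.
  transitivity (a^* * (a * x + b * y + m * z) + a * (a^* * x + b^* * y + m^* * z)
     + 2 * x * (c - a * a^*) + y * (- c - (a * b^* + a^* * b)) + z * (- c - (a * m^* + a^* * m))).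
    ring.
  by rewrite sdp sdp' aa ab am !subrr !mulr0 !addr0.
move/eqP; rewrite mulf_eq0 (negPf c_neq0) subr_eq0 /= => /eqP x3.
by rewrite -[x](mulKf (_ : 3 != 0)) ?x3 ?mulr1 // pnatr_eq0.
Qed.
End Flattening.

Lemma trmxC_mul (C : numClosedFieldType) m n p (A : 'M[C]_(m, n)) (B : 'M[C]_(n, p)) :
  (A *m B)^t* = B^t* *m A^t*.
Proof. by rewrite trmx_mul map_mxM. Qed.

Lemma hermitian_pair_normal (C : numClosedFieldType) n (A B : 'M[C]_n) c :
    A^t* = A -> B^t* = B -> A *m B = B *m A -> A *m A + B *m B = c%:M ->
  let N := A + 'i *: B in N *m N^t* = c%:M /\ N^t* *m N = c%:M.
Proof.
move=> A_herm B_herm AB AABB /=.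
have -> : (A + 'i *: B)^t* = A - 'i *: B.
  by rewrite linearD linearZ /= map_mxD map_mxZ /= A_herm B_herm conjCi scaleNr.
rewrite mulmxDl !mulmxBr mulmxBl !mulmxDr -!scalemxAl -!scalemxAr !scalerA -expr2 sqrCi.
rewrite !scaleN1r -AABB AB.
by split; apply/matrixP => i j; rewrite !mxE; ring.
Qed.

Lemma flat_frame (R : rcfType) (F : 'M[R[i]]_(3, 7)) (G := F^t* *m F) :
    (forall i, G i i = 1) ->
    (forall i j, i != j -> G i j * (G i j)^* = 2 / 9) ->
    F *m F^t* = (7 / 3)%:M ->
  exists2 E : 'M[R[i]]_(3, 7),
    E^t* *m E = G & forall k i, E k i * (E k i)^* = 3^-1.
Proof.
move=> G_diag G_off FF.
have G_herm : G^t* = G by rewrite trmxC_mul trmxCK.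
pose P i := col i F *m (col i F)^t*.
have PE i k l : P i k l = F k i * (F l i)^* by rewrite mxE big_ord1 !mxE.
have trP (X : 'M[R[i]]_3) i : \tr (P i *m X) = (F^t* *m X *m F) i i.
  rewrite /P -[in LHS]mulmxA mxtrace_mulC trace_mx11 tr_col map_row -row_mul.
  by rewrite 2!mxE; apply: eq_bigr => l _; rewrite !mxE.
have P_herm i : (P i)^t* = P i by rewrite trmxC_mul trmxCK.
have trPP i j : \tr (P i *m P j) = (i == j)%:R * (7 / 9) + 2 / 9.
  transitivity (G i j * (G i j)^*).
    have -> : (G i j)^* = G j i by rewrite -[in RHS]G_herm !mxE.
    rewrite trP /P mulmxA -mulmxA tr_col map_row -row_mul mxE big_ord1 [row j _ _ _]mxE.
    by congr (_ * _); rewrite !mxE; apply: eq_bigr => l _; rewrite !mxE.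
  case: eqVneq => [->|/G_off->]; last by rewrite mul0r add0r.
  by rewrite G_diag rmorph1 /= mulr1 mul1r; field.
have sumP : \sum_i P i = (7 / 3)%:M.
  rewrite -FF; apply/matrixP => k l; rewrite summxE mxE.
  by apply: eq_bigr => i _; rewrite PE !mxE.
have [A [B [[A_herm B_herm] trPAB trABs T]]] := hermitian_complement P_herm trPP sumP.
have tr0 (X : 'M[R[i]]_3) : (forall i, \tr (P i *m X) = 0) -> \tr X = 0.
  move=> PX; have : \tr ((7 / 3)%:M *m X) = 0.
    by rewrite -sumP mulmx_suml raddf_sum big1 //= => i _; exact: PX.
  rewrite mul_scalar_mx mxtraceZ => /eqP; rewrite mulf_eq0 => /orP[|/eqP//].
  by rewrite mulf_eq0 invr_eq0 !pnatr_eq0.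
have trA : \tr A = 0 by apply: tr0 => i; case: (trPAB i).
have trB : \tr B = 0 by apply: tr0 => i; case: (trPAB i).
have [|AB AABB] := commuting_pair trA trB trABs.
  move=> k l k' l'.
  (* [P i] has rank one, so these products are unchanged when [l] and [l'] are swapped. Comparing
     the two instances of [T] leaves the constant 1 - 2/3 = 1/3. *)
  have : \sum_i P i k l * P i k' l' = \sum_i P i k l' * P i k' l.
    by apply: eq_bigr => i _; rewrite !PE; ring.
  move=> /(congr1 (fun x => 9 / 7 * x)); rewrite !T (eq_sym l' k') (eq_sym k' l).
  move/eqP; rewrite eq_sym -subr_eq0 => /eqP E.
  by rewrite -[RHS]addr0 -[in RHS]E; field.
have /= := hermitian_pair_normal A_herm B_herm AB AABB.
set N := A + 'i *: B => -[NN1 NN2].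
have trN : \tr N = 0 by rewrite mxtraceD mxtraceZ trA trB mulr0 addr0.
have trPN i : \tr (P i *m N) = 0.
  case: (trPAB i) => PA PB.
  by rewrite mulmxDr -scalemxAr mxtraceD mxtraceZ PA PB mulr0 addr0.
have N_normal : N \is normalmx by apply/normalmxP; rewrite NN1.
set U := spectralmx N; set d := spectral_diag N.
have U_unitary : U \is unitarymx := spectral_unitarymx N.
have UU : U^t* *m U = 1%:M by rewrite -invmx_unitary // mulVmx // unitarymx_unit.
have NE : N = U^t* *m diag_mx d *m U.
  by rewrite -invmx_unitary //; apply/orthomx_spectralP.
have gramUF : (U *m F)^t* *m (U *m F) = G.
  by rewrite trmxC_mul mulmxA -[_ *m U]mulmxA UU mulmx1.
exists (U *m F) => // k i; set E := U *m F in gramUF *.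
have UNU : diag_mx d = U *m N *m U^t*.
  by rewrite NE !mulmxA (unitarymxP U_unitary) mul1mx -mulmxA (unitarymxP U_unitary) mulmx1.
(* The eigenvalues have squared modulus 2/3 and sum [\tr N = 0]; [\tr (P i *m N) = 0] balances them
   with the squared moduli of column [i] of [E] as weights. *)
apply: (@flat_coordinates _ (fun k => d 0 k) (fun k => E k i * (E k i)^*) (2 / 3)).
- by rewrite mulf_neq0 ?invr_eq0 ?pnatr_eq0.
- move=> l; have : diag_mx d *m (diag_mx d)^t* = (2 / 3)%:M.
    rewrite UNU !trmxC_mul trmxCK !mulmxA -[_ *m U^t* *m U]mulmxA UU mulmx1.
    by rewrite -[U *m N *m N^t*]mulmxA NN1 mul_mx_scalar -scalemxAl (unitarymxP U_unitary) scalemx1.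
  by move=> /matrixP/(_ l l); rewrite mul_diag_mx !mxE eqxx.
- by rewrite -mxtrace_diag UNU mxtrace_mulC mulmxA UU mul1mx.
- by move=> l; rewrite rmorphM /= conjCK mulrC.
- rewrite -(G_diag i) -gramUF mxE; apply: eq_bigr => l _.
  by rewrite !mxE mulrC.
- transitivity ((F^t* *m N *m F) i i); last by rewrite -trP trPN.
  rewrite NE !mulmxA -trmxC_mul -/E -mulmxA -/E -mulmxA mxE; apply: eq_bigr => l _.
  by rewrite mul_diag_mx !mxE; ring.
Qed.

(** * Seven points on the torus *)

Section Torus.
Variable C : numClosedFieldType.

Lemma unit_conj (x : C) : x * x^* = 1 -> x != 0 /\ x^* = x^-1.
Proof.
move=> xx; have x_neq0 : x != 0.
  by apply: contra_eq_neq xx => ->; rewrite mul0r eq_sym oner_eq0.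
by split=> //; rewrite -[LHS](mulKf x_neq0) xx mulr1.
Qed.

(** The exponents are 0 and the six differences of (0,0), (1,0), (0,1), a root system of type A2.
    Positions in the list index the characters below. *)
Definition hexagon (x y : C) : seq C :=
  [:: 1; x; x^-1; y; y^-1; x * y^-1; x^-1 * y].

(* The hypothesis on a and b says that |1 + a + b|^2 = 2, which is the
   orthogonality of the columns i and j of the character matrix X below. *)
Lemma torus_relation (x y : 'I_7 -> C) :
    (forall i, x i * (x i)^* = 1) -> (forall i, y i * (y i)^* = 1) ->
    x 0 = 1 -> y 0 = 1 ->
    (forall i j, i != j -> let a := x j / x i in let b := y j / y i in
       (1 + a + b) * (1 + a^-1 + b^-1) = 2) ->
  (forall i, x i = y i ^+ 3) \/ (forall i, x i ^+ 2 = y i ^+ 3).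
Proof.
move=> xx yy x0 y0 dist.
have xn0 i : x i != 0 by have [] := unit_conj (xx i).
have yn0 i : y i != 0 by have [] := unit_conj (yy i).
have xC i : (x i)^* = (x i)^-1 by have [] := unit_conj (xx i).
have yC i : (y i)^* = (y i)^-1 by have [] := unit_conj (yy i).
pose X := \matrix_(h < 7, i < 7) (hexagon (x i) (y i))`_h.
pose Y := \matrix_(i < 7, h < 7) (hexagon (x i)^-1 (y i)^-1)`_h.
have YX : Y *m X = 7%:M.
  apply/matrixP => i j; rewrite mxE !big_ord_recl big_ord0 !mxE /=.
  have [->|/dist /= E] := eqVneq i j; first by rewrite mulr1n; field; rewrite ?xn0 ?yn0.
  rewrite mulr0n -[RHS](subrr 2) -[X in X - _]E; field; by rewrite !xn0 !yn0.
(* A left inverse of a square matrix is a right inverse: orthogonality of the points turns into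
   orthogonality of the characters. *)
have XY : X *m Y = 7%:M.
  have : Y *m (7^-1 *: X) = 1%:M.
    by rewrite -scalemxAr YX scale_scalar_mx mulVf // pnatr_eq0.
  move/mulmx1C; rewrite -scalemxAl => /(congr1 (fun M => 7 *: M)).
  by rewrite scalerA mulfV ?pnatr_eq0 // scale1r scale_scalar_mx mulr1.
have orth h k : (h < 7)%N -> (k < 7)%N -> h != k ->
    \sum_i (hexagon (x i) (y i))`_h * (hexagon (x i)^-1 (y i)^-1)`_k = 0.
  move=> lt_h lt_k neq_hk; have /matrixP/(_ (Ordinal lt_h) (Ordinal lt_k)) := XY.
  rewrite !mxE -val_eqE /= (negPf neq_hk) mulr0n => XY0; rewrite -[RHS]XY0.
  by apply: eq_bigr => i _; rewrite !mxE.
pose g i := x i / y i ^+ 2.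
pose s := 7^-1 * \sum_i x i / y i ^+ 3.
pose t := 7^-1 * \sum_i x i ^+ 2 / y i ^+ 3.
have gE j : g j = s * y j + t * (y j / x j).
  (* For five of the characters, x/y^2 divided by the character is a quotient of two distinct
     characters, so the coefficient vanishes. Only y (index 3) and y/x (index 6) survive. *)
  pose coef h := \sum_i g i * (hexagon (x i)^-1 (y i)^-1)`_h.
  have coef0 l h k : (h < 7)%N -> (k < 7)%N -> h != k ->
      (forall i, g i * (hexagon (x i)^-1 (y i)^-1)`_l =
        (hexagon (x i) (y i))`_h * (hexagon (x i)^-1 (y i)^-1)`_k) ->
      coef l = 0.
    by move=> lt_h lt_k hk gE; rewrite /coef (eq_bigr _ (fun i _ => gE i)); exact: orth.
  have : 7 * g j = \sum_(h < 7) coef h * (hexagon (x j) (y j))`_h.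
    transitivity ((\row_i g i *m (Y *m X)) 0 j).
      by rewrite YX mul_mx_scalar !mxE.
    rewrite mulmxA mxE; apply: eq_bigr => h _; rewrite !mxE; congr (_ * _).
    by apply: eq_bigr => i _; rewrite !mxE.
  rewrite !big_ord_recl big_ord0 /= /bump !add1n /=.
  rewrite (coef0 0 5 3) // => [|i]; last by rewrite /g /=; field; rewrite ?yn0.
  rewrite (coef0 1 4 3) // => [|i]; last by rewrite /g /=; field; rewrite ?xn0 ?yn0.
  rewrite (coef0 2 5 6) // => [|i]; last by rewrite /g /=; field; rewrite ?xn0 ?yn0.
  rewrite (coef0 4 5 0) // => [|i]; last by rewrite /g /=; field; rewrite ?xn0 ?yn0.
  rewrite (coef0 5 4 0) // => [|i]; last by rewrite /g /=; field; rewrite ?xn0 ?yn0.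
  have -> : coef 3 = 7 * s.
    rewrite mulVKf ?pnatr_eq0 //; apply: eq_bigr => i _.
    by rewrite /g /=; field; rewrite ?yn0.
  have -> : coef 6 = 7 * t.
    rewrite mulVKf ?pnatr_eq0 //; apply: eq_bigr => i _.
    by rewrite /g /=; field; rewrite ?xn0 ?yn0.
  move=> E; apply: (mulfI (_ : 7 != 0)); first by rewrite pnatr_eq0.
  by rewrite E; ring.
move: s t gE => s t gE.
have rel i : x i / y i ^+ 3 = s + t / x i.
  transitivity (g i / y i); first by rewrite /g; field; rewrite ?yn0.
  by rewrite gE; field; rewrite ?xn0 ?yn0.
have st1 : s + t = 1.
  by have := rel 0; rewrite x0 y0 expr1n !divr1 => <-.
have sx : \sum_i x i = 0.
  rewrite -[RHS](orth 1%N 0%N isT isT isT); apply: eq_bigr => i _.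
  by rewrite /= mulr1.
have sx2 : \sum_i x i ^+ 2 = 0.
  rewrite -[RHS](orth 1%N 2%N isT isT isT); apply: eq_bigr => i _.
  by rewrite /= invrK.
have mod1 i : (s + t / x i) * (s^* + t^* * x i) = 1.
  have <- : (s + t / x i)^* = s^* + t^* * x i.
    by rewrite rmorphD rmorphM fmorphV /= xC invrK.
  rewrite -rel rmorphM fmorphV rmorphXn /= xC yC; field.
  by rewrite xn0 yn0.
pose c := s * s^* + t * t^*.
have cross i : c - 1 + s * t^* * x i + s^* * t / x i = 0.
  by rewrite -(mod1 i) /c; field; rewrite xn0.
(* Multiply [cross] by [x i] and sum over the points: x and x^2 sum to zero, leaving 7 [s^* * t]. *)
have st : s^* * t = 0.
  have : \sum_i ((c - 1) * x i + s * t^* * x i ^+ 2 + s^* * t) = 0.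
    apply: big1 => i _; apply: (mulIf (invr_neq0 (xn0 i))); rewrite mul0r -(cross i).
    by field; rewrite xn0.
  rewrite !big_split /= -!mulr_sumr sx sx2 !mulr0 !add0r sumr_const card_ord mulrnAr.
  by move/eqP; rewrite mulrn_eq0 => /eqP.
move/eqP: st; rewrite mulf_eq0 conjC_eq0 => /orP[] /eqP E; [right|left] => i.
  have t1 : t = 1 by rewrite -st1 E add0r.
  have := rel i; rewrite E t1 add0r mul1r => xyx.
  rewrite -[y i ^+ 3]mulr1 -(mulfV (xn0 i)) -xyx; field.
  by rewrite yn0.
have s1 : s = 1 by rewrite -st1 E addr0.
have := rel i; rewrite E s1 mul0r addr0 => xy.
by rewrite -[RHS]mul1r -xy mulfVK // expf_neq0.
Qed.
End Torus.

(** * Reduction to the difference set {0, 1, 3} *)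

Section Circulant.
Variable C : numClosedFieldType.

(** [u] carries the phases and the norm 1/sqrt 3. The last condition, with [z 0 = 1], encodes that
    [z] enumerates the seventh roots of unity. *)
Definition circulant_gram (G : 'M[C]_7) :=
  exists u z : 'I_7 -> C,
    [/\ forall i, u i * (u i)^* = 3^-1, z 0 = 1,
        forall i j, G i j = (u i)^* * u j * (1 + z j / z i + (z j / z i) ^+ 3)
      & forall i j, i != j -> \sum_(k < 7) (z j / z i) ^+ k = 0].

(** The nonzero differences of 0, 1, 3 are 1, 2, 3 and their negatives, once each, so the product
    minus 2 is the sum of w^k for k from -3 to 3. *)
Lemma geometric_sum7 (w : C) : w != 0 ->
  (1 + w ^+ 3 + w) * (1 + (w ^+ 3)^-1 + w^-1) = 2 -> \sum_(k < 7) w ^+ k = 0.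
Proof.
move=> w_neq0 ww; apply: (mulIf (invr_neq0 (expf_neq0 3 w_neq0))).
rewrite mul0r -[RHS](subrr 2) -[X in X - _]ww !big_ord_recl big_ord0.
by rewrite /= /bump /=; field.
Qed.

Lemma flat_circulant (E : 'M[C]_(3, 7)) (G := E^t* *m E) :
    (forall k i, E k i * (E k i)^* = 3^-1) ->
    (forall i j, i != j -> G i j * (G i j)^* = 2 / 9) ->
  circulant_gram G.
Proof.
move=> flat G_off.
have en0 k i : E k i != 0.
  by apply: contra_eq_neq (flat k i) => ->; rewrite mul0r eq_sym invr_eq0 pnatr_eq0.
have eC k i : (E k i)^* = (3 * E k i)^-1.
  by rewrite invfM -(flat k i) mulrC mulKf.
(* Row ratios, normalized to equal 1 at point 0; the normalizing phases cancel in the Gram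
   matrix. *)
pose x i := E 1 i / E 0 i * (E 0 0 / E 1 0).
pose y i := E 2 i / E 0 i * (E 0 0 / E 2 0).
have xn0 i : x i != 0 by rewrite !mulf_neq0 ?invr_eq0.
have yn0 i : y i != 0 by rewrite !mulf_neq0 ?invr_eq0.
have xx i : x i * (x i)^* = 1.
  by rewrite /x !rmorphM !fmorphV /= !eC; field; rewrite !en0.
have yy i : y i * (y i)^* = 1.
  by rewrite /y !rmorphM !fmorphV /= !eC; field; rewrite !en0.
have x0 : x 0 = 1 by rewrite /x; field; rewrite !en0.
have y0 : y 0 = 1 by rewrite /y; field; rewrite !en0.
have GE i j : G i j = 3^-1 * (E 0 j / E 0 i) * (1 + x j / x i + y j / y i).
  rewrite mxE !big_ord_recl big_ord0 !mxE !eC.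
  have -> : lift ord0 ord0 = 1 :> 'I_3 by exact: val_inj.
  have -> : lift ord0 (lift ord0 ord0) = 2 :> 'I_3 by exact: val_inj.
  by rewrite -[ord0]/(0 : 'I_3) /x /y; field; rewrite !en0.
have GC i j : (G i j)^* = G j i.
  by rewrite !mxE rmorph_sum; apply: eq_bigr => k _; rewrite !mxE rmorphM /= conjCK mulrC.
have dist i j : i != j -> let a := x j / x i in let b := y j / y i in
    (1 + a + b) * (1 + a^-1 + b^-1) = 2.
  move=> /G_off; rewrite GC !GE /= => Gij.
  have -> : 2 = 9 * (2 / 9) :> C by rewrite mulrC divfK // pnatr_eq0.
  by rewrite -[in RHS]Gij; field; rewrite xn0 yn0 xn0 yn0 !en0.
have [xy|xy] := torus_relation xx yy x0 y0 dist.
  exists (E 0), y; split=> // [i j|i j neq_ij].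
    by rewrite GE eC !xy; field; rewrite yn0 en0.
  apply: geometric_sum7; first by rewrite mulf_neq0 ?invr_eq0.
  by have /= := dist i j neq_ij; rewrite !xy expr_div_n.
(* Here the exponents of r are 0, 3, 2. Since 1 + r^3 + r^2 = r^3 (1 + r^-1 + r^-3), moving [x] into
   [u] and taking [z] inverse to [r] restores {0, 1, 3}. *)
pose r i := x i / y i; have rn0 i : r i != 0 by rewrite mulf_neq0 ?invr_eq0.
have yE i : y i = r i ^+ 2 by rewrite expr_div_n xy; field; rewrite yn0.
have xE i : x i = r i ^+ 3 by rewrite expr_div_n -xy; field; rewrite xn0.
exists (fun i => E 0 i * x i), (fun i => (r i)^-1); split=> [i||i j|i j neq_ij].
- by rewrite rmorphM mulrACA flat xx mulr1.
- by rewrite /r x0 y0 divr1 invr1.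
- have -> : (E 0 i * x i)^* = (3 * E 0 i * x i)^-1.
    by rewrite rmorphM invfM -eC; have [_ <-] := unit_conj (xx i).
  by rewrite GE !yE !xE; move: (r i) (r j) (rn0 i) (rn0 j) => p q p0 q0; field; rewrite p0 q0 en0.
apply: geometric_sum7; first by rewrite mulf_neq0 ?invr_eq0.
have /= <- := dist i j neq_ij; rewrite !yE !xE.
by move: (r i) (r j) (rn0 i) (rn0 j) => p q p0 q0; field; rewrite p0 q0.
Qed.
End Circulant.

(** * Equivalence and existence *)

Section Equivalence.
Variable C : numClosedFieldType.

(** In [gram_equiv] the diagonal matrix acts before the permutation, so its entries are those of [e]
    reindexed by the inverse of [s]. *)
Lemma gram_equiv_switch n (G G' : 'M[C]_n) (s : 'S_n) (e : 'I_n -> C) :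
    (forall i, e i * (e i)^* = 1) ->
    (forall i j, G' i j = e i * G (s i) (s j) * (e j)^*) ->
  gram_equiv G G'.
Proof.
move=> ee GG'; pose D : 'M[C]_n := diag_mx (\row_a e ((s^-1)%g a)).
have DC : D^t* = diag_mx (\row_a (e ((s^-1)%g a))^*).
  by rewrite tr_diag_mx map_diag_mx; congr diag_mx; apply/rowP => a; rewrite !mxE.
exists (perm_mx s), D; split.
- exact: perm_mx_is_perm.
- exact: diag_mx_is_diag.
- apply/unitarymxP; rewrite DC; apply/matrixP => a b.
  by rewrite mul_diag_mx !mxE mulrnAr ee.
rewrite tr_perm_mx -col_permE -!mulmxA -row_permE DC mul_mx_diag mul_diag_mx.
by apply/matrixP => i j; rewrite !mxE !permK mulrA.
Qed.

(** Comparison with index 0 gives w^7 - 1 = (w - 1) * 0; a repeated value would make a geometric sum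
    equal to 7. *)
Lemma circulant_roots (z : 'I_7 -> C) : z 0 = 1 ->
    (forall i j, i != j -> \sum_(k < 7) (z j / z i) ^+ k = 0) ->
  (forall i, z i ^+ 7 = 1) /\ injective z.
Proof.
move=> z0 sz; have z7 i : z i ^+ 7 = 1.
  have [->|] := eqVneq i 0; first by rewrite z0 expr1n.
  rewrite eq_sym => /sz; rewrite z0 divr1 => s0.
  by apply/eqP; rewrite -subr_eq0 subrX1 s0 mulr0.
split=> // i j zij; apply/eqP; apply: contraT => /sz /eqP.
have zj_neq0 : z j != 0.
  by apply: contra_eq_neq (z7 j) => ->; rewrite expr0n eq_sym oner_eq0.
rewrite zij mulfV //; under eq_bigr do rewrite expr1n.
by rewrite sumr_const card_ord pnatr_eq0.
Qed.

Lemma circulant_equiv (G G' : 'M[C]_7) :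
  circulant_gram G -> circulant_gram G' -> gram_equiv G G'.
Proof.
move=> [u [z [uu z0 GE sz]]] [u' [z' [uu' z0' GE' sz']]].
have [z7 z_inj] := circulant_roots z0 sz.
have [z7' z_inj'] := circulant_roots z0' sz'.
have /fin_all_exists[s sE] i : exists j, z' i = z j.
  suff /codomP : z' i \in codom z by [].
  apply/negPn/negP => z'_notin.
  (* Otherwise there would be eight distinct seventh roots of unity. Hence [z'] is [z] up to a
     permutation. *)
  have : (size (z' i :: codom z) <= 7)%N.
    apply: max_unity_roots => //; last by rewrite /= z'_notin map_inj_uniq ?enum_uniq.
    rewrite /= unity_rootE z7' eqxx; apply/allP => _ /codomP[j ->].
    by rewrite unity_rootE z7.
  by rewrite /= size_codom card_ord.
have s_inj : injective s by move=> i j sij; apply: z_inj'; rewrite !sE sij.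
have un0 i : u i != 0.
  by apply: contra_eq_neq (uu i) => ->; rewrite mul0r eq_sym invr_eq0 pnatr_eq0.
apply: (@gram_equiv_switch _ _ _ (perm s_inj) (fun i => (u' i)^* / (u (s i))^*)) => [i|i j].
  rewrite rmorphM fmorphV /= !conjCK mulrACA -invfM ![_^* * _]mulrC uu uu' mulfV //.
  by rewrite invr_eq0 pnatr_eq0.
rewrite !permE GE' GE !sE rmorphM fmorphV /= !conjCK; field.
have zn0 k : z k != 0.
  by apply: contra_eq_neq (z7 k) => ->; rewrite expr0n eq_sym oner_eq0.
by rewrite zn0 un0 conjC_eq0 un0.
Qed.

(** * Existence: the cyclic frame *)

(** A root of 1 + X + ... + X^6 is a seventh root of unity other than 1, hence primitive as 7 is
    prime. *)
Lemma prim_root7_exists : exists w : C, 7.-primitive_root w.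
Proof.
have [w] : exists w : C, root (\poly_(k < 7) 1) w.
  by apply/closed_rootP; rewrite size_poly_eq ?oner_eq0.
rewrite /root horner_poly => /eqP w_sum.
have sw : \sum_(k < 7) w ^+ k = 0.
  by rewrite -[RHS]w_sum; apply: eq_bigr => k _; rewrite mul1r.
have w7 : w ^+ 7 = 1 by apply/eqP; rewrite -subr_eq0 subrX1 sw mulr0.
have [m w_prim] := prim_order_exists (isT : 0 < 7)%N w7.
have /primeP[_ divisors7] : prime 7 by [].
case/divisors7/orP => /eqP m_eq; last by exists w; rewrite -m_eq.
have w1 : w = 1 by rewrite -(prim_expr_order w_prim) m_eq.
move/eqP: sw; rewrite w1; under eq_bigr do rewrite expr1n.
by rewrite sumr_const card_ord pnatr_eq0.
Qed.

Lemma geometric_unity_root n (r : C) : r ^+ n = 1 -> r != 1 ->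
  \sum_(k < n) r ^+ k = 0.
Proof.
move=> rn r1; apply/eqP; have /eqP := subrX1 r n.
by rewrite rn subrr eq_sym mulf_eq0 subr_eq0 (negPf r1).
Qed.

Lemma prim_root_conj n (w : C) : n.-primitive_root w -> w * w^* = 1.
Proof.
move=> w_prim; rewrite -normCK; apply/eqP; rewrite sqrf_eq1; apply/orP; left.
rewrite -(@pexpr_eq1 _ _ n (prim_order_gt0 w_prim)) ?normr_ge0 // -normrX.
by rewrite (prim_expr_order w_prim) normr1.
Qed.

(** Rows 0, 1, 3 of the Fourier matrix of order 7, scaled to unit columns. *)
Definition cyclic_frame (w : C) (i : 'I_7) : 'cV[C]_3 :=
  \col_k (sqrtC 3^-1 * w ^+ (nth 0 [:: 0; 1; 3] k * i)%N).

Lemma cyclic_frame_equiangular (w : C) :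
  7.-primitive_root w -> equiangular_frame (cyclic_frame w).
Proof.
move=> w_prim; have ww := prim_root_conj w_prim.
have [w_neq0 wC] := unit_conj ww.
have w7 : w ^+ 7 = 1 := prim_expr_order w_prim.
set s : C := sqrtC 3^-1.
have sC : s^* = s by rewrite geC0_conj // sqrtC_ge0 invr_ge0.
have ss : s * s = 3^-1 by rewrite -expr2 sqrtCK.
have sum0 a b : (a < 7)%N -> (b < 7)%N -> a != b ->
    \sum_(k < 7) (w ^+ a / w ^+ b) ^+ k = 0.
  move=> lt_a lt_b neq_ab; apply: geometric_unity_root.
    by rewrite expr_div_n -!exprM mulnC [(b * 7)%N]mulnC !exprM w7 !expr1n divr1.
  apply: contra neq_ab => /eqP wab; have : w ^+ a == w ^+ b.
    by rewrite -[w ^+ b]mul1r -wab mulfVK ?expf_neq0.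
  by rewrite (eq_prim_root_expr w_prim) !modn_small.
have hE (i j : 'I_7) (r := w ^+ j / w ^+ i) :
    hdot (cyclic_frame w i) (cyclic_frame w j) = 3^-1 * (1 + r ^+ 3 + r).
  rewrite /hdot mxE !big_ord_recl big_ord0 !mxE /=.
  rewrite !rmorphM !rmorphXn /= -/s sC wC -ss /r.
  rewrite !mul0n !mul1n ![(3 * _)%N]mulnC !exprM !exprVn.
  have := expf_neq0 i w_neq0; move: (w ^+ i) (w ^+ j) => p q p_neq0.
  by field.
have rn0 (i j : 'I_7) : w ^+ j / w ^+ i != 0 by rewrite mulf_neq0 ?invr_eq0 ?expf_neq0.
split=> // [i|i j lt_ij|].
- rewrite /hnorm hE divff ?expf_neq0 // !expr1n (_ : 3^-1 * _ = 1) ?sqrtC1 //.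
  by field.
- rewrite -[LHS](sqrCK (normr_ge0 _)) normCK hE; congr (sqrtC _).
  have := sum0 j i (ltn_ord j) (ltn_ord i); rewrite gtn_eqF // => /(_ isT) rsum.
  have rC : (w ^+ j / w ^+ i)^* = (w ^+ j / w ^+ i)^-1.
    by rewrite rmorphM fmorphV !rmorphXn /= wC !exprVn invfM.
  rewrite rmorphM fmorphV rmorph_nat !rmorphD rmorphXn rmorph1 /= rC.
  move: (rn0 i j) rsum; move: (w ^+ j / w ^+ i) => r r_neq0 rsum.
  (* The difference set identity again; the value 2/9 is (7 - 3) / (3 * 6). *)
  transitivity (9^-1 * (2 + r ^- 3 * \sum_(k < 7) r ^+ k)).
    by rewrite !big_ord_recl big_ord0 /= /bump /=; field.
  by rewrite rsum; field.
apply/matrixP => k l; rewrite !mxE.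
pose e (k : 'I_3) := nth 0%N [:: 0; 1; 3]%N k.
have lt_e m : (e m < 7)%N by case: m => [[|[|[|]]]].
transitivity (3^-1 * \sum_(i < 7) (w ^+ e k / w ^+ e l) ^+ i).
  rewrite mulr_sumr; apply: eq_bigr => i _; rewrite !mxE rmorphM rmorphXn /= wC.
  by rewrite -/s sC -ss expr_div_n -!exprM exprVn; ring.
have [->|neq_kl] := eqVneq k l.
  rewrite divff ?expf_neq0 //; under eq_bigr do rewrite expr1n.
  by rewrite sumr_const card_ord mulr1n mulrC.
rewrite sum0 ?mulr0 ?mulr0n //.
by case: k l neq_kl => [[|[|[|]]]] // ? [[|[|[|]]]].
Qed.

End Equivalence.

Theorem proposition4p2 (R : realType) :
  (exists phi : 'I_7 -> 'cV[R[i]]_3, equiangular_frame phi) /\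
  (forall phi psi : 'I_7 -> 'cV[R[i]]_3,
     equiangular_frame phi -> equiangular_frame psi ->
     gram_equiv (gram_mx phi) (gram_mx psi)).
Proof.
split; last first.
  have circ (phi : 'I_7 -> 'cV[R[i]]_3) : equiangular_frame phi ->
      circulant_gram (gram_mx phi).
    case=> _ _ _ unit angle tight.
    have GE i j : gram_mx phi i j = hdot (phi i) (phi j).
      by rewrite /hdot !mxE; apply: eq_bigr => k _; rewrite !mxE.
    have G_diag i : gram_mx phi i i = 1.
      by rewrite GE -[LHS]sqrtCK; have := unit i; rewrite /hnorm => ->; rewrite expr1n.
    have G_off i j : i != j -> gram_mx phi i j * (gram_mx phi i j)^* = 2 / 9.
      have GC : (gram_mx phi i j)^* = gram_mx phi j i.
        rewrite !mxE rmorph_sum; apply: eq_bigr => k _.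
        by rewrite !mxE rmorphM /= conjCK mulrC.
      have norm2 (k l : 'I_7) : (k < l)%N ->
          gram_mx phi k l * (gram_mx phi k l)^* = 2 / 9.
        by move=> lt_kl; rewrite -normCK GE angle // sqrtCK; field.
      (* The frame axiom covers only i < j; the other order follows by conjugation. *)
      rewrite neq_ltn => /orP[/norm2//|/norm2].
      by rewrite -GC conjCK mulrC.
    have [E EG flat] := flat_frame G_diag G_off tight.
    rewrite -[gram_mx phi]EG; apply: flat_circulant => // i j; rewrite EG; exact: G_off.
  by move=> phi psi /circ Gphi /circ Gpsi; exact: circulant_equiv.
have [w w_prim] := prim_root7_exists R[i].
by exists (cyclic_frame w); exact: cyclic_frame_equiangular.
Qed.
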